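(* Let $K$ be a field with a non-trivial valuation $v$ and let $A(x)=\sum_{i=0}^n a_ix^i\in K[x]$ be a polynomial of degree $n$. Assume that the characteristic of the residue field of $v$ does not divide $n$. If the set $\{A(x)\,g\begin{pmatrix}0&1\\1&0\end{pmatrix}: g\in L(2,K)\}$ contains an Eisenstein–Dumas polynomial at $v$, then $a_0\neq0$ and $L(A(x))=\big(1-\frac{a_1}{na_0}x\big)^nA\big(\frac{x}{1-\frac{a_1}{na_0}x}\big)$ is an Eisenstein–Dumas polynomial at $v$.
   Context: $v:K\to\Gamma\cup\{\infty\}$ is a non-trivial Krull valuation with values in a linearly ordered abelian group $\Gamma$; $K$ is not assumed henselian; the residue field is $R_v/M_v$ with $R_v=\{v\ge0\}$, $M_v=\{v>0\}$. $L(2,K)$ is the group of invertible lower triangular $2\times2$ matrices over $K$. Action: for $A$ of degree $n$, $A(x)\begin{pmatrix}a&b\\c&d\end{pmatrix}=(cx+d)^nA\big(\frac{ax+b}{cx+d}\big)$, regarded as a polynomial of formal degree $n$; note $L(A(x))=A(x)\begin{pmatrix}1&0\\-\frac{a_1}{na_0}&1\end{pmatrix}$. A polynomial written $\sum_{i=0}^n b_ix^i$ is Eisenstein–Dumas at $v$ if (D0) $b_0b_n\neq0$; (D1) $v(b_0)-v(b_n)\notin k\Gamma=\{kg:g\in\Gamma\}$ for every integer $k>1$ dividing $n$; (D2) $nv(b_i)\ge (n-i)v(b_0)+iv(b_n)$ for $0\le i\le n$.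
   Formalization: The degree n is assumed to be at least 2; for n = 1 the claim fails: A(x) = 1 + x with g the identity gives the Eisenstein–Dumas polynomial x + 1, but L(A(x)) = 1 has b_1 = 0, violating (D0). *)

(* Defs.v *)
From HB Require Import structures.
From mathcomp Require Import all_boot all_order all_algebra.
Set Implicit Arguments.
Unset Strict Implicit.
Unset Printing Implicit Defensive.
Import Order.TTheory GRing.Theory Num.Theory.
Local Open Scope ring_scope.

(** * Linearly ordered abelian groups *)

(* Totality is an axiom of the mixin rather than inherited from [orderType]:
   joining the order hierarchy above [Num.POrderedZmodule] would clash with
   [Num.RealDomain], which is declared earlier. *)
HB.mixin Record POrderedZmodule_isOrderedGroup G of Num.POrderedZmodule G := {
  og_le_total : forall x y : G, (x <= y) || (y <= x);
  og_leD2l : forall x y z : G, y <= z -> x + y <= x + z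
}.

#[short(type="orderedGroupType")]
HB.structure Definition OrderedGroup :=
  {G of Num.POrderedZmodule G & POrderedZmodule_isOrderedGroup G}.

(** * The ordered monoid [Gamma] together with a greatest, absorbing element *)

Definition with_top (G : Type) : Type := option G.
Definition infty {G : Type} : with_top G := None.

HB.instance Definition _ (G : choiceType) := Choice.on (with_top G).

Section WithTopNmod.
Variable G : zmodType.
Implicit Types x y z : with_top G.

Definition wt_add x y : with_top G :=
  if x is Some a then if y is Some b then Some (a + b) else infty else infty.

Let wt_addA : associative wt_add.
Proof. by move=> [a|] [b|] [c|] //=; rewrite addrA. Qed.
Let wt_addC : commutative wt_add.
Proof. by move=> [a|] [b|] //=; rewrite addrC. Qed.
Let wt_add0 : left_id (Some 0 : with_top G) wt_add.
Proof. by move=> [a|] //=; rewrite add0r. Qed.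

HB.instance Definition _ :=
  GRing.isNmodule.Build (with_top G) wt_addA wt_addC wt_add0.

(* Total version of the inclusion's inverse; the value at [infty] is junk. *)
Definition finite_part x : G := odflt 0 x.
End WithTopNmod.

Section WithTopOrder.
Variable G : orderedGroupType.
Implicit Types x y z : with_top G.

Definition wt_le x y : bool :=
  if y is Some b then if x is Some a then a <= b else false else true.

Let wt_le_refl : reflexive wt_le.
Proof. by move=> [a|] /=. Qed.
Let wt_le_anti : antisymmetric wt_le.
Proof. by move=> [a|] [b|] //= /le_anti ->. Qed.
Let wt_le_trans : transitive wt_le.
Proof. by move=> [a|] [b|] [c|] //=; apply: le_trans. Qed.
Let wt_le_total : total wt_le.
Proof. by move=> [a|] [b|] //=; apply: og_le_total. Qed.

HB.instance Definition _ :=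
  Order.Le_isPOrder.Build ring_display (with_top G)
    wt_le_refl wt_le_anti wt_le_trans.
HB.instance Definition _ :=
  Order.POrder_isTotal.Build ring_display (with_top G) wt_le_total.
End WithTopOrder.

(** * Krull valuations *)

Record valuation (K : fieldType) (G : orderedGroupType) := Valuation {
  val_fun :> K -> with_top G;
  val_eq_infty : forall x, val_fun x = infty <-> x = 0;
  val_mul : forall x y, val_fun (x * y) = val_fun x + val_fun y;
  val_add : forall x y,
    Num.min (val_fun x) (val_fun y) <= val_fun (x + y)
}.

Definition nontrivial (K : fieldType) (G : orderedGroupType)
    (v : valuation K G) : Prop :=
  exists2 x : K, x != 0 & v x <> 0.

Section ResidueField.
Variables (K : fieldType) (G : orderedGroupType) (v : valuation K G).

Lemma valuation0 : v 0 = infty.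
Proof. exact/val_eq_infty. Qed.

Lemma valuation1 : v 1 = 0.
Proof.
have := val_mul v 1 1; rewrite mulr1.
case E: (v 1) => [a|].
  by case=> /eqP; rewrite -subr_eq0 opprD addrA subrr sub0r oppr_eq0 => /eqP ->.
by move/val_eq_infty/eqP: E; rewrite oner_eq0.
Qed.

Lemma og_addr_ge0 (a b : G) : 0 <= a -> 0 <= b -> 0 <= a + b.
Proof.
by move=> a0 b0; apply: le_trans a0 _; rewrite -{1}[a]addr0 og_leD2l.
Qed.

Lemma valuationN1 : v (- 1) = 0.
Proof.
have := val_mul v (- 1) (- 1); rewrite mulrNN mulr1 valuation1.
case: (v (- 1)) => [a|] // [] /esym aa0; congr Some; apply: le_anti.
have /orP[a0|a0] := og_le_total a 0; rewrite a0 ?andbT /=.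
  by move: (og_leD2l a a 0 a0); rewrite aa0 addr0.
by move: (og_leD2l a 0 a a0); rewrite aa0 addr0.
Qed.

Lemma valuationN x : v (- x) = v x.
Proof. by rewrite -mulN1r val_mul valuationN1 add0r. Qed.

Definition val_ring_pred : K -> bool := fun x => (0 : with_top G) <= v x.

Fact val_ring_subring : subring_closed val_ring_pred.
Proof.
rewrite /val_ring_pred; split=> [|x y|x y]; rewrite !unfold_in.
- by rewrite valuation1.
- move=> vx vy; apply: le_trans (val_add v x (- y)).
  by rewrite valuationN le_min vx.
- rewrite val_mul; case: (v x) (v y) => [a|] [b|] //=.
  exact: og_addr_ge0.
Qed.

HB.instance Definition _ :=
  GRing.isSubringClosed.Build K val_ring_pred val_ring_subring.

Record val_ring := ValRing {
  val_ring_val : K;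
  val_ring_valP : val_ring_val \in val_ring_pred
}.

HB.instance Definition _ := [isSub for val_ring_val].
HB.instance Definition _ := [Choice of val_ring by <:].
HB.instance Definition _ := [SubChoice_isSubComNzRing of val_ring by <:].

Definition val_ideal : val_ring -> bool := fun x => (0 : with_top G) < v (val x).

Fact val_ideal_idealr : idealr_closed val_ideal.
Proof.
split=> [||a x y]; rewrite ?unfold_in /val_ideal.
- by rewrite rmorph0 valuation0.
- by rewrite rmorph1 valuation1 ltxx.
move=> vx vy; rewrite rmorphD rmorphM.
apply: lt_le_trans (val_add v _ _).
rewrite lt_min vy andbT val_mul.
have : (0 : with_top G) <= v (val a) by exact: (valP a).
move: vx; case: (v (val x)) => [b|]; case: (v (val a)) => [c|] //= b0 c0.
have c0' : (0 : G) <= c by exact: c0.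
move: b0; rewrite !lt_neqAle => /andP[b0 b0'].
have b0'' : (0 : G) <= b by exact: b0'.
have cb : (0 : G) <= c + b by exact: og_addr_ge0.
apply/andP; split; last exact: cb.
apply: contra b0 => /eqP [] E; apply/eqP; congr Some; apply: le_anti.
by rewrite b0'' /= E -{1}[b]add0r [0 + b]addrC [c + b]addrC og_leD2l.
Qed.

HB.instance Definition _ :=
  isIdealr.Build val_ring val_ideal val_ideal_idealr.

Definition val_max : idealr val_ring := Idealr.clone val_ring val_ideal _.

Definition residue_field : Type := {ideal_quot val_max}.
HB.instance Definition _ := GRing.ComNzRing.on residue_field.

Definition residue_class (x : val_ring) : residue_field :=
  \pi_({ideal_quot val_max})%qT x.

Definition residue_inv (q : residue_field) : residue_field :=
  if q == 0 then 0
  else residue_class (insubd 0 (val (repr (q : {ideal_quot val_max})))^-1).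

Fact residue_mulVf q : q != 0 -> residue_inv q * q = 1.
Proof.
move=> q0; rewrite /residue_inv (negPf q0).
have qE : q = residue_class (repr (q : {ideal_quot val_max})).
  by rewrite /residue_class reprK.
move: (repr _) qE q0 => x -> x0.
have {}x0 : x \notin (val_ideal : {pred val_ring}).
  apply: contra x0 => xM.
  by rewrite /residue_class piE Quotient.equivE subr0.
have vx : v (val x) = 0.
  apply/eqP; move: (valP x) x0.
  rewrite !unfold_in /val_ring_pred /val_ideal lt_neqAle => ->.
  by rewrite andbT negbK eq_sym.
have xn0 : val x != 0.
  by apply/eqP => xE; move: vx; rewrite xE valuation0.
have vxV : v (val x)^-1 = 0.
  by have := val_mul v (val x) (val x)^-1; rewrite divff // valuation1 vx add0r.
have xVP : (val x)^-1 \in val_ring_pred.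
  by rewrite unfold_in /val_ring_pred vxV.
rewrite /residue_class -rmorphM -(rmorph1 \pi_({ideal_quot val_max})%qT).
by congr (\pi_(_)%qT _); apply: val_inj; rewrite /= insubdK // mulVf.
Qed.

Fact residue_inv0 : residue_inv 0 = 0.
Proof. by rewrite /residue_inv eqxx. Qed.

HB.instance Definition _ :=
  GRing.ComNzRing_isField.Build residue_field residue_mulVf residue_inv0.

End ResidueField.

(* The characteristic as a natural number; [pchar F] only records the
   positive (prime) characteristic, and is empty in characteristic 0. *)
Definition has_characteristic (F : fieldType) (p : nat) : Prop :=
  if p is 0%N then [pchar F] =i pred0 else p \in [pchar F].

(** * The action of 2 x 2 matrices on polynomials of formal degree [n] *)

Section Action.
Variable K : fieldType.

Definition mx22 (a b c d : K) : 'M[K]_2 :=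
  \matrix_(i, j) if i == 0 then (if j == 0 then a else b)
                 else (if j == 0 then c else d).

(* [(c x + d) ^ n A((a x + b) / (c x + d))] with denominators cleared; the
   formal degree [n] may exceed the actual degree of [A], cf.
   [mobius_act_fracE]. *)
Definition mobius_act (n : nat) (A : {poly K}) (M : 'M[K]_2) : {poly K} :=
  \sum_(i < n.+1) A`_i *:
    ((M 0 0 *: 'X + (M 0 1)%:P) ^+ i * (M 1 0 *: 'X + (M 1 1)%:P) ^+ (n - i)).

Lemma mobius_act_fracE n (A : {poly K}) (M : 'M[K]_2) : (size A <= n.+1)%N ->
  M 1 0 *: 'X + (M 1 1)%:P != 0 ->
  let lin a b : {fraction {poly K}} := tofrac (a *: 'X + b%:P) in
  tofrac (mobius_act n A M) =
    lin (M 1 0) (M 1 1) ^+ n *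
    (map_poly (@tofrac {poly K} \o polyC) A).[lin (M 0 0) (M 0 1)
                                              / lin (M 1 0) (M 1 1)].
Proof.
move=> sA den0 lin.
have den0' : lin (M 1 0) (M 1 1) != 0 by rewrite tofrac_eq0.
rewrite (horner_coef_wide _ (leq_trans (size_poly _ _) sA)) mulr_sumr rmorph_sum.
apply: eq_bigr => i _; rewrite coef_map /= -mul_polyC !rmorphM !rmorphXn /=.
rewrite -/(lin _ _) -/(lin _ _) [in RHS]mulrCA; congr (_ * _).
rewrite expr_div_n [in RHS]mulrCA; congr (_ * _).
apply: (mulIf (expf_neq0 i den0')).
by rewrite mulfVK ?expf_neq0 // -exprD subnK ?leq_ord.
Qed.

(* [is_trig_mx] is MathComp's "lower triangular". *)
Definition L2 : {pred 'M[K]_2} := [pred g | is_trig_mx g && (g \in unitmx)].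

Definition L_normal (n : nat) (A : {poly K}) : {poly K} :=
  mobius_act n A (mx22 1 0 (- (A`_1 / (n%:R * A`_0))) 1).

End Action.

Arguments L2 K : clear implicits.

(* [B] is read as a polynomial [\sum_(i <= n) B`_i x^i] of formal degree [n]. *)
Definition eisenstein_dumas (K : fieldType) (G : orderedGroupType)
    (v : valuation K G) (n : nat) (B : {poly K}) : Prop :=
  [/\ (size B <= n.+1)%N,
      B`_0 * B`_n != 0,
      forall k : nat, (1 < k)%N -> (k %| n)%N ->
        ~ exists g : G,
            finite_part (v B`_0) - finite_part (v B`_n) = g *+ k
    & forall i : nat, (i <= n)%N ->
        v B`_0 *+ (n - i) + v B`_n *+ i <= v B`_i *+ n].

(* Main.v *)
(* The matrices of [L2] only rescale a normal form: if [C = A g] with [g] lower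
   triangular, then [L(A)] is [L(C)] acted on by a diagonal matrix, and a
   diagonal action changes [v(b_0) - v(b_n)] by an element of [n Gamma].
   As the reversal [x |-> 1/x] also preserves the Eisenstein-Dumas property, it
   suffices that [L(C)] is Eisenstein-Dumas when [C] is.  There
   [L(C) = (1 + f x)^n C(x / (1 + f x))] with [f = - c_1 / (n c_0)], and since
   [n] is a residual unit, (D2) at [i = 1] bounds [n v(f)] from below by
   [v(c_n) - v(c_0)], strictly by (D1) at [k = n].  All terms of all
   coefficients then lie on or above the Newton line, and only [c_n] itself
   reaches it in degree [n]. *)
Require Import Defs.
From HB Require Import structures.
From mathcomp Require Import all_boot all_order all_algebra.
From mathcomp Require Import ring.
Set Implicit Arguments.
Unset Strict Implicit.
Unset Printing Implicit Defensive.
Import Order.TTheory GRing.Theory Num.Theory.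
Local Open Scope ring_scope.

Local Notation fin a := (Some a : with_top _).

(** * Ordered arithmetic with the top element adjoined *)

Section WithTopArithmetic.
Variable G : orderedGroupType.
Implicit Types (a b : G) (x y z w : with_top G).

Lemma wt_leD x y z w : x <= y -> z <= w -> x + z <= y + w.
Proof.
case: y w => [b|] [d|] //; case: x z => [a|] [c|] // ab cd.
have le1 : a + c <= a + d by exact: og_leD2l.
have le2 : d + a <= d + b by exact: og_leD2l.
suff : a + c <= b + d by [].
by apply: le_trans le1 _; rewrite addrC [b + d]addrC.
Qed.

Lemma wt_addI a : injective (+%R (fin a)).
Proof. by move=> [b|] [c|] //= [] /addrI ->. Qed.

Lemma wt_leD2lI a x y : fin a + x <= fin a + y -> x <= y.
Proof.
move/(wt_leD (lexx (fin (- a)))); rewrite !addrA.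
by rewrite (_ : fin (- a) + fin a = 0) ?add0r //; congr Some; rewrite addNr.
Qed.

(** A finite summand cancels, so adding it keeps the inequality strict; adding [infty] would not. *)
Lemma wt_ltD a y z w : fin a <= y -> z < w -> fin a + z < y + w.
Proof.
move=> ay zw; have := wt_leD (lexx (fin a)) (ltW zw).
rewrite le_eqVlt => /orP[/eqP /wt_addI zE|lt1].
  by rewrite zE ltxx in zw.
by apply: lt_le_trans lt1 _; apply: wt_leD.
Qed.

Lemma wt_leMn x y n : x <= y -> x *+ n <= y *+ n.
Proof.
by move=> xy; elim: n => [|n IHn]; rewrite ?mulr0n // !mulrS wt_leD.
Qed.

Lemma wt_SomeMn a n : fin a *+ n = fin (a *+ n).
Proof. by elim: n => [|n IHn] //; rewrite !mulrS IHn. Qed.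

Lemma wt_ltMn a y n : (0 < n)%N -> fin a < y -> fin a *+ n < y *+ n.
Proof.
case: n => // n _ ay; elim: n => [|n IHn]; first by rewrite !mulr1n.
by rewrite mulrS [y *+ _]mulrS wt_ltD // ltW.
Qed.

Lemma wt_ltMnW x y n : x *+ n < y *+ n -> x < y.
Proof. by apply: contraTT; rewrite -!leNgt; exact: wt_leMn. Qed.

End WithTopArithmetic.

(** * Valuations of powers, sums and integers *)

Section Valuation.
Variables (K : fieldType) (G : orderedGroupType) (v : valuation K G).
Implicit Types (x y : K) (m : with_top G).

Lemma valuation_neq0 x : x != 0 -> exists a : G, v x = Some a.
Proof.
case E: (v x) => [a|]; first by exists a.
by move/val_eq_infty: E => ->; rewrite eqxx.
Qed.

Lemma valuation_fin_neq0 x (a : G) : v x = Some a -> x != 0.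
Proof. by move=> E; apply/eqP => x0; rewrite x0 valuation0 in E. Qed.

Lemma valuationX x n : v (x ^+ n) = v x *+ n.
Proof.
elim: n => [|n IHn]; first by rewrite valuation1.
by rewrite exprS val_mul IHn mulrS.
Qed.

(** The bound is finite so that the empty sum, of valuation [infty], satisfies it strictly. *)
Lemma valuation_sum_gt (I : finType) (P : pred I) (F : I -> K) (a : G) :
  (forall i, P i -> fin a < v (F i)) -> fin a < v (\sum_(i | P i) F i).
Proof.
move=> mF; elim/big_rec: _ => [|i x Pi mx]; first by rewrite valuation0.
by apply: lt_le_trans (val_add _ _ _); rewrite lt_min mF.
Qed.

(** The group need not be divisible, so Newton-line bounds are stated on [n]-fold multiples.
    Positivity of [n] keeps the multiple of [infty] infinite. *)
Lemma valuation_sumMn_ge (I : finType) (P : pred I) (F : I -> K) m n :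
    (0 < n)%N -> (forall i, P i -> m <= v (F i) *+ n) ->
  m <= v (\sum_(i | P i) F i) *+ n.
Proof.
move=> n0 mF; elim/big_rec: _ => [|i x Pi mx].
  by rewrite valuation0; case: n n0 {mF} => // n _; rewrite mulrS; case: m.
apply: le_trans (wt_leMn n (val_add _ _ _)).
by rewrite minEle; case: ifP => _; rewrite ?mF.
Qed.

(** As [x = (x + y) - y], the minimum of [v (x + y)] and [v y] is at most [v x], and [v y] is too
    large to attain it. *)
Lemma valuationD_lt x y : v x < v y -> v (x + y) = v x.
Proof.
move=> xy; apply/le_anti/andP; split; last first.
  by apply: le_trans (val_add _ _ _); rewrite le_min lexx ltW.
have := val_add v (x + y) (- y); rewrite addrK valuationN ge_min.
by case/orP => // /(lt_le_trans xy); rewrite ltxx.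
Qed.

Lemma valuation_nat_ge0 n : (0 : with_top G) <= v n%:R.
Proof.
by have : n%:R \in (val_ring_pred v : {pred K}) by exact: rpred_nat.
Qed.

(** An integer of positive valuation vanishes in the residue field, hence is divisible by [p]; for
    [p = 0] this means that it is zero. *)
Lemma valuation_nat_eq0 p n :
  has_characteristic (residue_field v) p -> ~~ (p %| n)%N -> v n%:R = 0.
Proof.
move=> charp pn; apply/eqP; rewrite eq_le valuation_nat_ge0 andbT leNgt.
apply/negP => vn.
have n0 : n%:R = 0 :> residue_field v.
  have <- : \pi_({ideal_quot val_max v})%qT n%:R = n%:R :> residue_field v.
    exact: (rmorph_nat (\pi_({ideal_quot val_max v})%qT) n).
  apply/eqP; rewrite -[X in _ == X](rmorph0 \pi_({ideal_quot val_max v})%qT).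
  rewrite piE Quotient.equivE subr0.
  by rewrite unfold_in /val_ideal (rmorph_nat (val : val_ring v -> K)).
case: p charp pn => [/pcharf0P char0|p charp].
  by move: (char0 n); rewrite n0 eqxx dvd0n => <-.
by rewrite (dvdn_pcharf charp) n0 eqxx.
Qed.

End Valuation.

(** * The matrix action: composition law and coefficient formulas *)

Section MobiusAct.
Variable K : fieldType.
Implicit Types (A : {poly K}) (M N : 'M[K]_2) (a b c d : K).

Lemma mx22E a b c d :
  (mx22 a b c d 0 0 = a) * (mx22 a b c d 0 1 = b) *
  (mx22 a b c d 1 0 = c) * (mx22 a b c d 1 1 = d).
Proof. by rewrite !mxE. Qed.

Lemma mulmx2E M N i j : (M *m N) i j = M i 0 * N 0 j + M i 1 * N 1 j.
Proof.
rewrite mxE !big_ord_recl big_ord0 addr0.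
by congr (_ + M i _ * N _ j); apply: val_inj.
Qed.

Lemma mul_mx22 a b c d a' b' c' d' :
  mx22 a b c d *m mx22 a' b' c' d' =
  mx22 (a * a' + b * c') (a * b' + b * d') (c * a' + d * c') (c * b' + d * d').
Proof.
by apply/matrixP => i j; rewrite mulmx2E !mxE /=; do 2?case: (_ == 0).
Qed.

Lemma size_linX a b : (size (a *: 'X + b%:P : {poly K})%R <= 2)%N.
Proof.
rewrite (leq_trans (size_polyD _ _)) // geq_max size_polyC.
rewrite (leq_trans (size_scale_leq _ _)) ?size_polyX //.
by case: (b != 0).
Qed.

Lemma size_mobius_act n A M : (size (mobius_act n A M) <= n.+1)%N.
Proof.
apply: (leq_trans (size_sum _ _ _)); apply/bigmax_leqP => i _.
apply: (leq_trans (size_scale_leq _ _)).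
apply: (leq_trans (size_polyMleq _ _)).
have linX a b m : (size ((a *: 'X + b%:P : {poly K}) ^+ m)%R <= m.+1)%N.
  apply: (leq_trans (size_poly_exp_leq _ _)); rewrite ltnS.
  by rewrite -[leqRHS]mul1n leq_mul2r -subn1 leq_subLR size_linX orbT.
have := leq_add (linX (M 0 0) (M 0 1) i) (linX (M 1 0) (M 1 1) (n - i)%N).
by rewrite addSn addnS subnKC ?leq_ord // -!subn1 leq_subLR add1n.
Qed.

Lemma coef_linX_exp c d m k :
  ((c *: 'X + d%:P) ^+ m)`_k = c ^+ k * d ^+ (m - k) *+ 'C(m, k).
Proof.
rewrite addrC exprDn coef_sum.
have tE (i : 'I_m.+1) : (d%:P ^+ (m - i) * (c *: 'X) ^+ i *+ 'C(m, i))`_k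
    = if k == i then c ^+ k * d ^+ (m - k) *+ 'C(m, k) else 0.
  rewrite coefMn exprZn -scalerAr -rmorphXn coefZ coefCM coefXn.
  by case: eqP => [->|_]; rewrite ?mulr1 ?mulr0 ?mul0rn.
rewrite (eq_bigr _ (fun i _ => tE i)) -big_mkcond /=.
have [km|mk] := ltnP k m.+1.
  by rewrite (big_pred1 (Ordinal km)) // => i; rewrite /= eq_sym.
by rewrite bin_small // mulr0n big1.
Qed.

(** Compared in the fraction field, where the action of [N] is substitution of a quotient [r] with
    denominator [q]. *)
Lemma mobius_actM n A M N :
    N 1 0 *: 'X + (N 1 1)%:P != 0 :> {poly K} ->
  mobius_act n (mobius_act n A M) N = mobius_act n A (M *m N).
Proof.
move=> N0; apply/eqP; rewrite -tofrac_eq mobius_act_fracE ?size_mobius_act //.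
pose t : {rmorphism K -> {fraction {poly K}}} := @tofrac {poly K} \o polyC.
pose x : {fraction {poly K}} := tofrac 'X.
have linE a b : tofrac (a *: 'X + b%:P) = t a * x + t b.
  by rewrite -mul_polyC rmorphD rmorphM.
rewrite !linE; set q := t (N 1 0) * x + _; set r := _ / q.
have q0 : q != 0 by rewrite /q -linE tofrac_eq0.
(* Evaluating the linear form of a row of [M] at [r] and clearing [q] gives the same row of the
   product. *)
have rowE (i : 'I_2) : q * (map_poly t (M i 0 *: 'X + (M i 1)%:P)).[r] =
    tofrac ((M *m N) i 0 *: 'X + ((M *m N) i 1)%:P).
  rewrite rmorphD /= map_polyZ map_polyX map_polyC hornerD hornerZ.
  rewrite hornerX hornerC linE !mulmx2E !rmorphD !rmorphM mulrDr mulrCA.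
  rewrite /r (mulrCA q) divff // mulr1.
  by rewrite [X in _ + X = _]mulrC !mulrDr !mulrDl !mulrA addrACA.
rewrite /mobius_act !rmorph_sum horner_sum mulr_sumr; apply/eqP/eq_bigr => i _.
rewrite -[in RHS]mul_polyC !rmorphM !rmorphXn /= -!rowE map_polyZ hornerZ.
rewrite rmorphM !rmorphXn hornerM !horner_exp !exprMn mulrCA; congr (_ * _).
(* The factor [q ^+ n] supplies one [q] to each of the [i + (n - i)] linear forms. *)
by rewrite -{1}(subnKC (leq_ord i)) exprD mulrACA.
Qed.

(** The zero upper right entry makes the [i]-th summand divisible by ['X ^+ i], so only [i <= j]
    contribute. *)
Lemma coef_mobius_act_lower n A a c d j : (j <= n)%N ->
  (mobius_act n A (mx22 a 0 c d))`_j =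
  \sum_(i < j.+1)
    A`_i * a ^+ i * (c ^+ (j - i) * d ^+ (n - j) *+ 'C(n - i, j - i)).
Proof.
move=> jn; rewrite coef_sum (big_ord_widen n.+1 (fun i => A`_i * a ^+ i *
  (c ^+ (j - i) * d ^+ (n - j) *+ 'C(n - i, j - i)))) // [RHS]big_mkcond /=.
apply: eq_bigr => i _; rewrite !mx22E addr0 exprZn coefZ -scalerAl coefZ mulrA.
rewrite coefXnM ltnS ltnNge; case: leqP => [ij|_]; last by rewrite mulr0.
by rewrite coef_linX_exp subnBA // subnK // (leq_trans ij jn).
Qed.

Lemma coef_mobius_act_diag n A a d j : (j <= n)%N ->
  (mobius_act n A (mx22 a 0 0 d))`_j = A`_j * a ^+ j * d ^+ (n - j).
Proof.
move=> jn; rewrite coef_mobius_act_lower // big_ord_recr /= subnn bin0 mulr1n.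
rewrite expr0 mul1r big1 ?add0r // => i _.
by rewrite expr0n subn_eq0 leqNgt ltn_ord mul0r mul0rn mulr0.
Qed.

Lemma coef_mobius_act_swap n A j : (j <= n)%N ->
  (mobius_act n A (mx22 0 1 1 0))`_j = A`_(n - j).
Proof.
move=> jn; rewrite coef_sum (bigD1 (rev_ord (Ordinal (jn : j < n.+1)%N))) //=.
rewrite !mx22E scale0r scale1r add0r addr0 expr1n mul1r coefZ coefXn.
rewrite subSS subKn // eqxx mulr1 big1 ?addr0 // => i /eqP ij.
rewrite expr1n mul1r coefZ coefXn; case: eqP => [jE|_]; last by rewrite mulr0.
by case: ij; apply: val_inj; rewrite /= subSS jE subKn ?leq_ord.
Qed.

End MobiusAct.

(** * Stability of the Eisenstein-Dumas conditions *)

Section EisensteinDumas.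
Variables (K : fieldType) (G : orderedGroupType) (v : valuation K G).
Variable n : nat.
Implicit Types (A : {poly K}).

(** Reversing the coefficients negates the difference in (D1) and exchanges (D2) at [i] and at
    [n - i]. *)
Lemma eisenstein_dumas_swap A : (size A <= n.+1)%N ->
  eisenstein_dumas v n (mobius_act n A (mx22 0 1 1 0)) ->
  eisenstein_dumas v n A.
Proof.
move=> sA [_]; rewrite !coef_mobius_act_swap // subn0 subnn => b0n D1 D2.
split=> // [|k k1 kn [g gE]|i iN]; first by rewrite mulrC.
  by apply: (D1 k k1 kn); exists (- g); rewrite mulNrn -gE opprB.
have := D2 (n - i)%N (leq_subr _ _).
by rewrite coef_mobius_act_swap ?leq_subr // subKn // addrC.
Qed.

(** The valuation of the [j]-th coefficient is shifted by an amount affine in [j], which moves both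
    sides of (D2) equally. *)
Lemma eisenstein_dumas_diag A a d : a != 0 -> d != 0 ->
  eisenstein_dumas v n A ->
  eisenstein_dumas v n (mobius_act n A (mx22 a 0 0 d)).
Proof.
move=> a0 d0 [_ A0n D1 D2].
have [alpha va] := valuation_neq0 v a0; have [delta vd] := valuation_neq0 v d0.
move: (A0n); rewrite mulf_eq0 negb_or => /andP[A0 An].
have [c0 vA0] := valuation_neq0 v A0; have [cn vAn] := valuation_neq0 v An.
rewrite vA0 vAn /= in D1 D2.
split=> [||k k1 kn|i iN]; first exact: size_mobius_act.
- by rewrite !coef_mobius_act_diag // subnn subn0 !mulf_neq0 ?expf_neq0.
- rewrite !coef_mobius_act_diag // !val_mul !valuationX va vd vA0 vAn.
  rewrite subnn subn0 !wt_SomeMn /= !mulr0n !addr0 => -[g gE].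
  apply: (D1 k k1 kn); case/dvdnP: kn => m nE; rewrite nE in gE.
  (* With [n = m * k], the shift of the (D1) difference by [n] times [delta - alpha] is itself a
     multiple of [k]. *)
  exists (g + (alpha - delta) *+ m).
  rewrite mulrnDl -mulrnA -gE mulrnBl opprD [c0 + _ + _]addrACA.
  by rewrite !addrA subrK addrK.
rewrite !coef_mobius_act_diag // !val_mul !valuationX va vd vA0 vAn.
rewrite subnn subn0 !mulr0n !addr0 !mulrnDl -!mulrnA !(mulnC n).
rewrite addrACA -[leRHS]addrA.
by apply: wt_leD; [exact: D2 | rewrite addrC lexx].
Qed.

(** For [n = 1] the normal form would be constant, violating (D0). *)
Lemma eisenstein_dumas_L_normal A : v n%:R = 0 -> (1 < n)%N ->
  eisenstein_dumas v n A -> eisenstein_dumas v n (L_normal n A).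
Proof.
move=> vn n_gt1 [_ A0n D1 D2]; have n_gt0 := ltnW n_gt1.
move: (A0n); rewrite mulf_eq0 negb_or => /andP[A0 An].
have [alpha vA0] := valuation_neq0 v A0; have [beta vAn] := valuation_neq0 v An.
rewrite vA0 vAn /= in D1 D2.
have vnV : v n%:R^-1 = 0.
  have := val_mul v n%:R n%:R^-1.
  by rewrite divff ?(valuation_fin_neq0 vn) // valuation1 vn add0r.
set f := - (A`_1 / (n%:R * A`_0)).
(* This is [n] times the slope of the Newton line from [alpha] at 0 to [beta] at [n]; [sumE] moves
   along that line without subtracting in [with_top]. *)
pose delta := beta - alpha.
have sumE k j : fin alpha *+ (k + j) + fin delta *+ j
    = fin alpha *+ k + fin beta *+ j.
  rewrite !wt_SomeMn; congr Some.
  by rewrite /= mulrnBl mulrnDr -addrA; congr (_ + _); rewrite addrC subrK.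
have vf : fin delta < v f *+ n.
  rewrite lt_neqAle; apply/andP; split.
    (* If a_1 vanishes then [v f] is infinite and equality is impossible; a finite [v f] attaining
       equality contradicts (D1) at [k = n]. *)
    apply/eqP; case vfE: (v f) => [phi|]; last by case: (n) n_gt1 => [|[]].
    rewrite wt_SomeMn => -[phiE]; apply: (D1 n n_gt1 (dvdnn n)).
    by exists (- phi); rewrite mulNrn -phiE opprB.
  apply: (@wt_leD2lI _ (alpha *+ n)); rewrite -wt_SomeMn -mulrnDl -vA0 -val_mul.
  have -> : A`_0 * f = - A`_1 / n%:R.
    by rewrite /f; field; rewrite A0 (valuation_fin_neq0 vn).
  rewrite mulNr valuationN val_mul vnV addr0.
  have := sumE n.-1 1%N; rewrite addn1 prednK // mulr1n vA0 => ->.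
  by rewrite -subn1; apply: D2.
have coefE j : (j <= n)%N -> (L_normal n A)`_j =
    \sum_(i < j.+1) A`_i * (f ^+ (j - i) *+ 'C(n - i, j - i)).
  move=> jn; rewrite coef_mobius_act_lower //.
  by apply: eq_bigr => i _; rewrite !expr1n !mulr1.
have v_term i j : v (A`_i * (f ^+ (j - i) *+ 'C(n - i, j - i)))
    = v A`_i + v f *+ (j - i) + v 'C(n - i, j - i)%:R.
  by rewrite -mulr_natr !val_mul valuationX addrA.
have bin_ge0 i j : (0 : with_top G) <= v 'C(i, j)%:R *+ n.
  by rewrite -[leLHS](mul0rn _ n) wt_leMn // valuation_nat_ge0.
(* (D2) puts a_i above the line at [i], each of the [j - i] factors [f] climbs at least the slope,
   and binomials have nonnegative valuation. *)
have v_term_ge i j : (i <= j)%N -> (j <= n)%N ->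
    fin alpha *+ (n - j) + fin beta *+ j
    <= (v A`_i + v f *+ (j - i) + v 'C(n - i, j - i)%:R) *+ n.
  move=> ij jn; rewrite !mulrnDl -[leLHS]addr0 wt_leD //.
  have -> : fin beta *+ j = fin beta *+ (j - i) + fin beta *+ i.
    by rewrite -mulrnDr subnK.
  rewrite addrA -sumE addnBA // subnK //.
  rewrite addrAC wt_leD ?D2 ?(leq_trans ij) // -mulrnA mulnC mulrnA.
  by rewrite wt_leMn // ltW.
(* For [i < n] at least one factor [f] occurs, and its bound is strict. *)
have v_term_gt (i : 'I_n) :
    fin beta < v A`_i + v f *+ (n - i) + v 'C(n - i, n - i)%:R.
  apply: (@wt_ltMnW _ _ _ n); rewrite binn valuation1 addr0 mulrnDl.
  have eqi : fin (alpha *+ (n - i) + beta *+ i) =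
      fin alpha *+ (n - i) + fin beta *+ i.
    by rewrite !wt_SomeMn.
  have -> : fin beta *+ n
      = fin (alpha *+ (n - i) + beta *+ i) + fin delta *+ (n - i).
    have := sumE 0%N (n - i)%N; rewrite mulr0n add0r add0n eqi addrAC => ->.
    by rewrite -mulrnDr subnK // ltnW.
  apply: wt_ltD; first by rewrite eqi D2 // ltnW.
  by rewrite -mulrnA mulnC mulrnA wt_ltMn // subn_gt0.
have coef0 : (L_normal n A)`_0 = A`_0 by rewrite coefE // big_ord1 bin0 mulr1.
have vcoefn : v (L_normal n A)`_n = fin beta.
  rewrite coefE // big_ord_recr /= subnn bin0 mulr1 addrC valuationD_lt // vAn.
  by apply: valuation_sum_gt => i _; rewrite v_term v_term_gt.
split=> [||k k1 kn|j jn]; first exact: size_mobius_act.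
- by rewrite coef0 mulf_neq0 // (valuation_fin_neq0 vcoefn).
- by rewrite coef0 vcoefn vA0; exact: D1.
rewrite coef0 vcoefn vA0 coefE //.
apply: valuation_sumMn_ge => // i _.
by rewrite v_term v_term_ge // -ltnS.
Qed.

End EisensteinDumas.

(** * Comparison of the normal forms of A and of its triangular transform *)

Theorem theorem2p8 (K : fieldType) (Gamma : orderedGroupType)
    (v : valuation K Gamma) (v_nontrivial : nontrivial v)
    (n : nat) (n_gt1 : (1 < n)%N)
    (A : {poly K}) (degA : size A = n.+1)
    (p : nat) (charp : has_characteristic (residue_field v) p)
    (p_ndvd_n : ~~ (p %| n)%N)
    (has_ED : exists2 g : 'M[K]_2, g \in L2 K &
       eisenstein_dumas v n (mobius_act n (mobius_act n A g) (mx22 0 1 1 0))) :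
  A`_0 != 0 /\ eisenstein_dumas v n (L_normal n A).
Proof.
have vn := valuation_nat_eq0 charp p_ndvd_n.
have n0 : n%:R != 0 :> K := valuation_fin_neq0 vn.
have n_gt0 : (0 < n)%N := ltnW n_gt1.
have [g] := has_ED.
rewrite inE => /andP[trig_g]; rewrite unitmxE det_trig //.
rewrite !big_ord_recl big_ord0 mulr1 unitfE mulf_eq0 negb_or.
have -> : lift ord0 ord0 = 1 :> 'I_2 by apply: val_inj.
set a := g _ _; set d := g _ _ => /andP[a0 d0].
pose c := g 1 0.
have -> : g = mx22 a 0 c d.
  apply/matrixP => i j; rewrite !mxE.
  have is01 (k : 'I_2) : (k = 0) \/ (k = 1).
    by case: k => [[|[]]] // k2; [left | right]; apply: val_inj.
  have [-> | ->] := is01 i; have [-> | ->] := is01 j; rewrite //=.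
  exact: (is_trig_mxP trig_g).
move/(eisenstein_dumas_swap (size_mobius_act _ _ _)).
set C := mobius_act n A _ => ED_C.
have C0 : C`_0 = A`_0 * d ^+ n.
  by rewrite coef_mobius_act_lower // big_ord1 /= !mulr1 bin0 mul1r subn0 mulr1n.
have C1 : C`_1 = (n%:R * A`_0 * c + A`_1 * a) * d ^+ n.-1.
  rewrite coef_mobius_act_lower // !big_ord_recl big_ord0 /= /bump bin0 bin1 /=.
  by rewrite !subn0 subn1 addn0 subnn; ring.
(* By (D0) the constant coefficient of [C] is nonzero, and it is a multiple of that of [A]. *)
have A0 : A`_0 != 0.
  by have [_] := ED_C; rewrite C0 !mulf_eq0 !negb_or => /andP[/andP[]].
split=> //.
have /(eisenstein_dumas_diag (invr_neq0 a0) (invr_neq0 d0)) :=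
  eisenstein_dumas_L_normal vn n_gt1 ED_C.
suff -> : mobius_act n (L_normal n C) (mx22 a^-1 0 0 d^-1) = L_normal n A by [].
have lin_neq0 c' d' : d' != 0 -> c' *: 'X + d'%:P != 0 :> {poly K}.
  move=> d'0; apply/eqP => /(congr1 (fun q : {poly K} => q`_0)) /eqP.
  by rewrite coefD coefZ coefX mulr0 add0r coefC coef0 (negPf d'0).
(* This is what makes the product of [g], the normalising matrix of [C] and the diagonal matrix of
   [a^-1], [d^-1] equal to the normalising matrix of [A]. *)
have slopeE : C`_1 / (n%:R * C`_0) = c / d + a / d * (A`_1 / (n%:R * A`_0)).
  (* Splitting off one [d] exposes the power [d ^+ n.-1] shared with the linear coefficient, for
     [field] to cancel. *)
  have -> : C`_0 = A`_0 * d * d ^+ n.-1 by rewrite C0 -mulrA -exprS prednK.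
  rewrite C1; field.
  by rewrite n0 A0 d0 expf_neq0.
rewrite /L_normal slopeE !mobius_actM ?mul_mx22 ?mx22E ?lin_neq0
  ?invr_neq0 ?oner_neq0 //.
  by congr (mobius_act n A (mx22 _ _ _ _)); field; rewrite ?a0 ?d0 ?A0 ?n0.
by rewrite mulr0 add0r mul1r invr_neq0.
Qed.
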